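(* Any admissible family $f_n$ of order $m$ satisfies a simple differential equation of order $m$, i.e. a homogeneous linear differential equation $\sum_{k=0}^m p_k(n,x)\,f_n^{(k)}(x)=0$ with coefficients $p_k$ that are polynomials in $x$.
   Context: $K$ is one of $\mathbb{Q},\mathbb{R},\mathbb{C}$. A family $(f_n)_{n\in D}$ consists of functions $f_n(x)=f(n,x)$ of a continuous variable $x\in I$ ($I$ a finite or infinite real interval or a subset of $\mathbb{C}$), indexed by a discrete variable $n\in D$, where $D$ has the property $n\in D\Rightarrow n+1\in D$ (or $n\in D\Rightarrow n-1\in D$), e.g. $D=\mathbb{N}_0,\mathbb{Z},\mathbb{R}$ or $\mathbb{C}$; only indices lying in $D$ are considered. The symbol $f^{(j)}$ denotes the $j$-th derivative with respect to $x$. Derivative rule: the $f_n$ are differentiable with respect to $x$ and, for some $M\in\mathbb{N}$, either $f_n'(x)=\sum_{k=0}^{M-1} r_k(n,x)f_{n-k}(x)$ (backward) or $f_n'(x)=\sum_{k=0}^{M-1} r_k(n,x)f_{n+k}(x)$ (forward), where the $r_k$ are rational functions in $x$ (with coefficients in $K$). If $r_{M-1}(n,x)\not\equiv 0$, the order of the derivative rule is $M$. In an admissible family the order of the derivative rule can always be assumed to be at most the order of the recurrence equation. Recurrence equation: $\sum_{k=0}^m q_k(n,x)f_{n-k}(x)=0$, where $m\in\mathbb{N}$ and the $q_k$ are polynomials in $x$ (with coefficients in $K$). If $q_0(n,x)\not\equiv 0$ and $q_m(n,x)\not\equiv 0$, the order of the recurrence equation is $m$. The family $f_n$ is called admissible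 if it satisfies a recurrence equation and a derivative rule of these types; the order of the admissible family is the order of the recurrence equation. A differential equation $\sum_{k=0}^m p_k(n,x)f_n^{(k)}(x)=0$ has order $m$ if $p_m(n,x)\not\equiv 0$. *)

(* Defs.v *)
(* MathComp-Analysis *)
From HB Require Import structures.
From mathcomp Require Import all_boot all_order all_algebra.
From mathcomp Require Import all_classical all_reals all_analysis.
From mathcomp Require Import complex.
Set Implicit Arguments.
Unset Strict Implicit.
Unset Printing Implicit Defensive.
Import Order.TTheory GRing.Theory Num.Theory.
Import numFieldNormedType.Exports.
Local Open Scope classical_set_scope.
Local Open Scope ring_scope.

(* Declared at type numClosedFieldType so that the norm topology of
   MathComp-Analysis is inferred on it. *)
Definition C (R : realType) : numClosedFieldType := R[i].

Variant ground := GroundQ | GroundR | GroundC.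

Definition ground_field (R : realType) (g : ground) : fieldType :=
  match g with GroundQ => rat | GroundR => R | GroundC => C R end.

Definition ground_emb (R : realType) (g : ground) :
    {rmorphism ground_field R g -> C R} :=
  match g return {rmorphism ground_field R g -> C R} with
  | GroundQ => (@ratr (C R) : {rmorphism rat -> C R})
  | GroundR => (real_complex R : {rmorphism R -> C R})
  | GroundC => (idfun : {rmorphism C R -> C R})
  end.

(* The domain I of the continuous variable is a subset of the complex plane;
   difference quotients are restricted to I.  For I a real interval (embedded
   in the plane) this is the ordinary derivative of a real- or complex-valued
   function of a real variable, one-sided at the endpoints; for I open in the
   plane it is the complex derivative. *)
Section Derivative.
Variables (R : realType) (I : set (C R)).
Implicit Types (f : C R -> C R) (x : C R).

Definition diff_quot f x (y : C R) : C R := (f y - f x) / (y - x).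

Definition derivable_in f x : Prop :=
  cvg (diff_quot f x y @[y --> within I (dnbhs x)]).

Definition deriv_in f x : C R :=
  lim (diff_quot f x y @[y --> within I (dnbhs x)]).

Definition nderiv_in (j : nat) f : C R -> C R := iter j deriv_in f.

(* Existence of the j-th derivative at x requires the previous ones to exist
   at all points of I near x (x included). *)
Fixpoint nderivable_in (j : nat) f x : Prop :=
  if j is j'.+1 then
    (\forall y \near within I (nbhs x), nderivable_in j' f y) /\
    derivable_in (nderiv_in j' f) x
  else True.

End Derivative.

Section Families.
Variables (R : realType) (K : fieldType) (iota : {rmorphism K -> C R}).

Definition peval (p : {poly K}) (x : C R) : C R := (map_poly iota p).[x].

(* The rational function r has no pole at x, and its value there is v. *)
Definition rat_value (r : {fraction {poly K}}) (x v : C R) : Prop :=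
  exists a b : {poly K},
    [/\ peval b x != 0, r = tofrac a / tofrac b & v = peval a x / peval b x].

(* The discrete variable ranges over a subset D of the complex plane, which
   covers the naturals, the integers, the reals and the complex numbers. *)
Variables (I D : set (C R)).

(* An equation between members of the family is imposed at those n for which
   every index occurring in it lies in D. *)
Definition backward_rule (f : C R -> C R -> C R) (M : nat)
    (r : nat -> C R -> {fraction {poly K}}) : Prop :=
  forall n, (forall k, (k < M)%N -> D (n - k%:R)) ->
  forall x, I x ->
  forall v : nat -> C R, (forall k, (k < M)%N -> rat_value (r k n) x (v k)) ->
    deriv_in I (f n) x = \sum_(k < M) v k * f (n - k%:R) x.

Definition forward_rule (f : C R -> C R -> C R) (M : nat)
    (r : nat -> C R -> {fraction {poly K}}) : Prop :=
  forall n, (forall k, (k < M)%N -> D (n + k%:R)) ->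
  forall x, I x ->
  forall v : nat -> C R, (forall k, (k < M)%N -> rat_value (r k n) x (v k)) ->
    deriv_in I (f n) x = \sum_(k < M) v k * f (n + k%:R) x.

Definition derivative_rule (f : C R -> C R -> C R) : Prop :=
  (forall n, D n -> forall x, I x -> derivable_in I (f n) x) /\
  exists2 M : nat, (0 < M)%N &
  exists r : nat -> C R -> {fraction {poly K}},
    backward_rule f M r \/ forward_rule f M r.

(* The dependence of the coefficients on n is arbitrary, so the first and last
   ones are required to be nonzero polynomials in x for each relevant n. *)
Definition recurrence_of_order (f : C R -> C R -> C R) (m : nat) : Prop :=
  exists q : nat -> C R -> {poly K},
  forall n, (forall k, (k <= m)%N -> D (n - k%:R)) ->
    [/\ q 0%N n != 0, q m n != 0 &
        forall x, I x -> \sum_(k < m.+1) peval (q k n) x * f (n - k%:R) x = 0].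

Definition admissible_of_order (f : C R -> C R -> C R) (m : nat) : Prop :=
  recurrence_of_order f m /\ derivative_rule f.

(* g solves the differential equation with polynomial coefficients p 0, ...,
   p m, of order m.  Rational coefficients of a derivative rule may have poles
   in I, where g need not have m derivatives: existence of the derivatives is
   asserted at the regular points of the equation, and the equation itself at
   every point where it makes sense. *)
Definition simple_ode_of_order (g : C R -> C R) (m : nat)
    (p : nat -> {poly K}) : Prop :=
  [/\ p m != 0,
      forall x, I x -> peval (p m) x != 0 -> nderivable_in I m g x &
      forall x, I x -> nderivable_in I m g x ->
        \sum_(k < m.+1) peval (p k) x * nderiv_in I k g x = 0].

End Families.

(* Main.v *)
Require Import Defs.
From mathcomp Require Import all_boot all_order all_algebra.
From mathcomp Require Import all_classical all_reals all_analysis.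
From mathcomp Require Import complex ring zify.
Set Implicit Arguments.
Unset Strict Implicit.
Unset Printing Implicit Defensive.
Import GRing.Theory Num.Theory.
Import numFieldNormedType.Exports.
Local Open Scope classical_set_scope.
Local Open Scope ring_scope.

(** Going along the chain f_n, f_(n+1), ... (or f_n, f_(n-1), ..., according to
    the direction in which D is closed), the recurrence has nonzero first and
    last coefficients at every step, so it can be solved for either end: over
    the field of rational functions, any m consecutive members W_0, ..., W_(m-1)
    span every member of the chain ([chain_generated]).  Starting the window
    far enough from n puts all indices of the derivative rule into D, even when
    it runs against the direction of the chain.  Hence the window satisfies a
    first order linear system b W_i' = sum_k A_ik W_k, and b f_n = sum_k c_k W_k,
    with polynomial b <> 0, A and c, away from the zeros of b.

    Differentiating b f_n = c W repeatedly with that system gives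
    b^(j+1) f_n^(j) = c_j W for polynomial row vectors c_j of length m
    ([nderiv_in_jet]).  The m + 1 vectors c_0, ..., c_m are linearly dependent
    over the polynomials, and such a dependence is a differential equation of
    order at most m.  To get order exactly m, differentiate the dependence: its
    order goes up by one and its leading coefficient stays the same
    ([jet_relation]).

    Finally, the equation sum_k p_k b^(k+1) f_n^(k) = 0 has all its
    coefficients zero at the zeros of b, so it holds there trivially, and at
    the points where its leading coefficient does not vanish the derivatives
    of f_n exist ([system_ode]). *)

(** * Linear dependence of the coefficient vectors of successive derivatives *)

Section Jets.
Variables (K : fieldType) (m : nat).
Variables (b : {poly K}) (A : 'M[{poly K}]_m) (c : 'rV[{poly K}]_m).

(** If b g = c W and b W' = A W, then b^(j+1) g^(j) = (jet j) W: the three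
    terms come from differentiating the coefficients, the functions W and the
    factor b^-(j+1). *)
Fixpoint jet (j : nat) : 'rV[{poly K}]_m :=
  if j is j'.+1 then
    b *: map_mx (@deriv K) (jet j') + jet j' *m A
      - (b^`() *+ j'.+1) *: jet j'
  else c.

Lemma jetS j : jet j.+1 =
  b *: map_mx (@deriv K) (jet j) + jet j *m A - (b^`() *+ j.+1) *: jet j.
Proof. by []. Qed.

Lemma map_mx_derivZ (p : {poly K}) (u : 'rV[{poly K}]_m) :
  map_mx (@deriv K) (p *: u) = p^`() *: u + p *: map_mx (@deriv K) u.
Proof. by apply/rowP => i; rewrite !mxE derivM. Qed.

(** Formal differentiation of the relation: b times the derivative of
    sum_k p_k c_k, plus that sum times A, is again a combination of the vectors
    c_k, with p_s as the coefficient of c_(s+1). *)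
Lemma jet_relation_succ (s : nat) (p : nat -> {poly K}) :
  p s != 0 -> \sum_(k < s.+1) p k *: jet k = 0 ->
  exists p' : nat -> {poly K},
    p' s.+1 != 0 /\ \sum_(k < s.+2) p' k *: jet k = 0.
Proof.
move=> ps0 rel.
(* u comes from b p_k' and from the last term of c_(k+1), v from b p_k c_k'. *)
pose u k := if (k <= s)%N then b * (p k)^`() + b^`() *+ k.+1 * p k else 0.
pose v k := if k is k'.+1 then p k' else 0.
exists (fun k => u k + v k); split; first by rewrite /u ltnn add0r.
have -> : \sum_(k < s.+2) (u k + v k) *: jet k =
    \sum_(k < s.+1) (u k *: jet k + p k *: jet k.+1).
  under eq_bigr do rewrite scalerDl.
  rewrite !big_split /=; congr (_ + _).
    by rewrite big_ord_recr /= [u s.+1]/u ltnn scale0r addr0.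
  by rewrite big_ord_recl /= scale0r add0r.
transitivity (b *: map_mx (@deriv K) (\sum_(k < s.+1) p k *: jet k)
    + (\sum_(k < s.+1) p k *: jet k) *m A); last first.
  by rewrite rel raddf0 mul0mx scaler0 addr0.
rewrite raddf_sum mulmx_suml scaler_sumr -big_split /=.
apply: eq_bigr => k _; rewrite /u -ltnS ltn_ord map_mx_derivZ -scalemxAl.
by apply/rowP => i; rewrite !mxE; ring.
Qed.

(** A relation of actual order r <= s is differentiated s - r times. *)
Lemma jet_relation_lead (s : nat) (p : nat -> {poly K}) :
  (exists2 k, (k <= s)%N & p k != 0) -> \sum_(k < s.+1) p k *: jet k = 0 ->
  exists p' : nat -> {poly K},
    p' s != 0 /\ \sum_(k < s.+1) p' k *: jet k = 0.
Proof.
elim: s p => [|s IHs] p [k ks pk0] rel.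
  by exists p; split=> //; move: ks pk0; rewrite leqn0 => /eqP->.
have [ps0|ps0] := eqVneq (p s.+1) 0; last by exists p.
have [||p' [p's0 rel']] := IHs p.
- exists k => //; move: ks; rewrite leq_eqVlt => /orP[/eqP ks|//].
  by rewrite ks ps0 eqxx in pk0.
- by move: rel; rewrite big_ord_recr /= ps0 scale0r addr0.
exact: jet_relation_succ p's0 rel'.
Qed.

(** m + 1 vectors of length m over an integral domain are dependent: padded with
    a zero column they form a square matrix of determinant zero. *)
Lemma jet_relation : exists p : nat -> {poly K},
  p m != 0 /\ \sum_(k < m.+1) p k *: jet k = 0.
Proof.
pose J := \matrix_(i < m.+1, j < m.+1) oapp (jet i 0) 0 (insub (val j)).
have /det0P[v v0 vJ] : \det J == 0.
  rewrite -det_tr; apply/det0P; exists (delta_mx 0 ord_max).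
    apply/eqP => /matrixP /(_ 0 ord_max); rewrite !mxE !eqxx => /eqP.
    by rewrite oner_eq0.
  by apply/rowP => i; rewrite -rowE !mxE insubF //= ltnn.
apply: (@jet_relation_lead m (fun k => v 0 (inord k))).
  have [i vi0] : exists i, v 0 i != 0.
    apply/existsP; apply: contraR v0 => /existsPn v0; apply/eqP/rowP => i.
    by rewrite mxE; have /negPn/eqP := v0 i.
  by exists i; [rewrite -ltnS | rewrite inord_val].
apply/rowP => j; rewrite summxE.
have /rowP/(_ (widen_ord (leqnSn m) j)) := vJ.
rewrite !mxE => vJj; rewrite -[RHS]vJj; apply: eq_bigr => i _.
rewrite !mxE inord_val insubT ?ltn_ord //= => jm.
by congr (_ * jet _ _ _); apply: val_inj.
Qed.

End Jets.

(** * Derivatives relative to a subset of the plane *)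

Section Calculus.
Variables (R : realType) (I : set (C R)).
Implicit Types (f g : C R -> C R) (x l : C R).

Definition is_deriv_in f x l : Prop :=
  diff_quot f x y @[y --> within I (dnbhs x)] --> l.

Lemma deriv_inP f x : derivable_in I f x -> is_deriv_in f x (deriv_in I f x).
Proof. by []. Qed.

Lemma is_deriv_in_derivable f x l : is_deriv_in f x l -> derivable_in I f x.
Proof. by move=> fl; apply/cvg_ex; exists l. Qed.

(** This is what makes limits along I at x unique, hence [deriv_in] computable. *)
Lemma within_dnbhs_proper x :
  limit_point I x -> ProperFilter (within I (dnbhs x)).
Proof.
move=> Ix; apply: Build_ProperFilter_ex => P /Ix [y [yx Iy Py]].
by exists y; apply: Py.
Qed.

Lemma deriv_inE f x l :
  limit_point I x -> is_deriv_in f x l -> deriv_in I f x = l.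
Proof.
by move=> /within_dnbhs_proper Fx; apply: cvg_lim => //; exact: norm_hausdorff.
Qed.

(** Instance resolution does not see through the closed field C R to find the
    general instances of which this is a composite. *)
#[local] Instance punctured_filter x : Filter (within I (dnbhs x)).
Proof. exact: within_filter. Qed.

Lemma cvg_punctured (F G : C R -> C R) x l :
  (forall y, y != x -> F y = G y) ->
  F y @[y --> within I (dnbhs x)] --> l ->
  G y @[y --> within I (dnbhs x)] --> l.
Proof.
move=> FG; apply: cvg_trans; apply: near_eq_cvg.
have yx : \forall y \near within I (dnbhs x), y != x.
  exact: (@cvg_within _ _ _ I _ (nbhs_dnbhs_neq x)).
by near=> y; rewrite FG //; near: y.
Unshelve. all: by end_near. Qed.

Lemma is_deriv_in_near f g x l : I x ->
  (\forall y \near within I (nbhs x), f y = g y) ->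
  is_deriv_in f x l -> is_deriv_in g x l.
Proof.
move=> Ix fg; apply: cvg_trans; apply: near_eq_cvg.
have fgx : f x = g x by apply: (nbhs_singleton fg).
have fgd : \forall y \near within I (dnbhs x), f y = g y := nbhs_dnbhs fg.
by near=> y; rewrite /diff_quot fgx; congr ((_ - _) / _); near: y.
Unshelve. all: by end_near. Qed.

Lemma is_deriv_in_cst a x : is_deriv_in (fun=> a) x 0.
Proof.
apply: (@cvg_punctured (fun=> 0)) (@cvg_cst _ _ _ _ _) => y _.
by rewrite /diff_quot subrr mul0r.
Qed.

Lemma is_deriv_in_id x : is_deriv_in id x 1.
Proof.
apply: (@cvg_punctured (fun=> 1)) (@cvg_cst _ _ _ _ _) => y yx.
by rewrite /diff_quot divff // subr_eq0.
Qed.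

Lemma is_deriv_in_continuous f x l : is_deriv_in f x l ->
  f y @[y --> within I (dnbhs x)] --> f x.
Proof.
move=> fl.
have idx : y @[y --> within I (dnbhs x)] --> x.
  by move=> P /nbhs_dnbhs /(@cvg_within _ _ _ I).
pose proof (cvgD (cvgM fl (cvgB idx (cvg_cst x))) (cvg_cst (f x))) as lim.
rewrite subrr mulr0 add0r in lim; apply: cvg_punctured lim => y yx /=.
by rewrite /diff_quot /= divfK ?subr_eq0 // subrK.
Qed.

Lemma is_deriv_inD f g x l l' : is_deriv_in f x l -> is_deriv_in g x l' ->
  is_deriv_in (fun y => f y + g y) x (l + l').
Proof.
move=> fl gl; pose proof (cvgD fl gl) as lim.
apply: cvg_punctured lim => y _ /=.
by rewrite /diff_quot; ring.
Qed.

Lemma is_deriv_inM f g x l l' : is_deriv_in f x l -> is_deriv_in g x l' ->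
  is_deriv_in (fun y => f y * g y) x (l * g x + f x * l').
Proof.
move=> fl gl; have gc := is_deriv_in_continuous gl.
pose proof (cvgD (cvgM fl gc) (cvgM (cvg_cst (f x)) gl)) as lim.
apply: cvg_punctured lim => y _ /=.
by rewrite /diff_quot; ring.
Qed.

Lemma is_deriv_inV f x l : f x != 0 -> is_deriv_in f x l ->
  is_deriv_in (fun y => (f y)^-1) x (- l / f x ^+ 2).
Proof.
move=> fx0 fl; have fc := is_deriv_in_continuous fl.
pose proof (cvgM (cvgN fl) (cvgM (cvgV fx0 fc) (cvg_cst (f x)^-1))) as lim.
rewrite -expr2 exprVn in lim; apply: cvg_trans lim; apply: near_eq_cvg.
apply: filterS (cvgr_neq0 _ fc fx0) => y fy0 /=.
rewrite -[LHS]/(- diff_quot f x y * ((f y)^-1 / f x)) /diff_quot.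
move: (y - x)^-1 => d; field.
by rewrite fy0 fx0.
Qed.

Lemma is_deriv_in_sum (n : nat) (F : 'I_n -> C R -> C R) (l : 'I_n -> C R) x :
  (forall i, is_deriv_in (F i) x (l i)) ->
  is_deriv_in (fun y => \sum_i F i y) x (\sum_i l i).
Proof.
elim: n F l => [|n IHn] F l Fl.
  rewrite big_ord0; under eq_fun do rewrite big_ord0; exact: is_deriv_in_cst.
rewrite big_ord_recr; under eq_fun do rewrite big_ord_recr.
by apply: is_deriv_inD => //; apply: IHn.
Qed.

End Calculus.

(** * Polynomial functions *)

Section Peval.
Variables (R : realType) (K : fieldType) (iota : {rmorphism K -> C R}).
Implicit Types (p q : {poly K}) (x : C R).

Lemma pevalD p q x : peval iota (p + q) x = peval iota p x + peval iota q x.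
Proof. by rewrite /peval rmorphD hornerD. Qed.

Lemma pevalN p x : peval iota (- p) x = - peval iota p x.
Proof. by rewrite /peval rmorphN hornerN. Qed.

Lemma pevalM p q x : peval iota (p * q) x = peval iota p x * peval iota q x.
Proof. by rewrite /peval rmorphM hornerM. Qed.

Lemma pevalX p n x : peval iota (p ^+ n) x = peval iota p x ^+ n.
Proof. by rewrite /peval rmorphXn horner_exp. Qed.

Lemma pevalMn p n x : peval iota (p *+ n) x = peval iota p x *+ n.
Proof. by rewrite /peval rmorphMn hornerMn. Qed.

Lemma peval0 x : peval iota 0 x = 0.
Proof. by rewrite /peval rmorph0 horner0. Qed.

Lemma peval1 x : peval iota 1 x = 1.
Proof. by rewrite /peval rmorph1 hornerC. Qed.

Lemma is_deriv_in_peval (I : set (C R)) p x :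
  is_deriv_in I (peval iota p) x (peval iota p^`() x).
Proof.
elim/poly_ind: p => [|p a IHp].
  rewrite deriv0 peval0 (_ : peval iota 0 = fun=> 0).
    exact: is_deriv_in_cst.
  by apply/funext => y; rewrite peval0.
have -> : peval iota (p * 'X + a%:P) = fun y => peval iota p y * y + iota a.
  apply/funext => y; rewrite pevalD pevalM /peval map_polyX map_polyC.
  by rewrite hornerX hornerC.
have -> : peval iota (p * 'X + a%:P)^`() x =
    (peval iota p^`() x * x + peval iota p x * 1) + 0.
  rewrite derivD derivM derivX derivC addr0 mulr1 pevalD pevalM mulr1 addr0.
  by rewrite /peval map_polyX hornerX.
have did := is_deriv_inM IHp (@is_deriv_in_id R I x).
exact: is_deriv_inD did (@is_deriv_in_cst R I (iota a) x).
Qed.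

Lemma near_within_sub (I P Q : set (C R)) x :
  (forall y, I y -> P y -> Q y) ->
  (\forall y \near within I (nbhs x), P y) ->
  \forall y \near within I (nbhs x), Q y.
Proof.
move=> PQ nP; suff : nbhs x [set y | I y -> Q y] by [].
have {}nP : nbhs x [set y | I y -> P y] := nP.
by apply: filterS nP => y IP Iy; apply: PQ => //; exact: IP.
Qed.

Lemma near_peval_neq0 (I : set (C R)) p x : peval iota p x != 0 ->
  \forall y \near within I (nbhs x), peval iota p y != 0.
Proof.
move=> px0.
have pc := is_deriv_in_continuous (@is_deriv_in_peval I p x).
pose proof (cvgr_neq0 _ pc px0) as nx.
have : within I (dnbhs x) [set y | peval iota p y != 0] by exact: nx.
move=> nxI; suff : nbhs x [set y | I y -> peval iota p y != 0] by [].
rewrite dnbhsE; split; first exact: nxI.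
by move=> y ->.
Qed.

End Peval.

(** * Functions generated by a window of functions over the rational functions *)

Section Systems.
Variables (R : realType) (K : fieldType) (iota : {rmorphism K -> C R}).
Variables (I : set (C R)) (m : nat) (W : 'I_m -> C R -> C R).
Local Notation "p .{ x }" := (peval iota p x) (at level 2, format "p .{ x }").
Implicit Types (g : C R -> C R) (b : {poly K}) (c : 'rV[{poly K}]_m) (x : C R).

Definition comb c x : C R := \sum_i (c 0 i).{x} * W i x.

Lemma combD c d x : comb (c + d) x = comb c x + comb d x.
Proof.
by rewrite /comb -big_split; apply: eq_bigr => i _; rewrite mxE pevalD mulrDl.
Qed.

Lemma combZ b c x : comb (b *: c) x = b.{x} * comb c x.
Proof.
by rewrite /comb mulr_sumr; apply: eq_bigr => i _; rewrite mxE pevalM mulrA.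
Qed.

Lemma combN c x : comb (- c) x = - comb c x.
Proof.
by rewrite /comb -sumrN; apply: eq_bigr => i _; rewrite mxE pevalN mulNr.
Qed.

Lemma comb0 x : comb 0 x = 0.
Proof. by rewrite /comb big1 // => i _; rewrite mxE peval0 mul0r. Qed.

Lemma comb_sum (T : Type) (r : seq T) (P : pred T) (F : T -> 'rV[{poly K}]_m) x :
  comb (\sum_(i <- r | P i) F i) x = \sum_(i <- r | P i) comb (F i) x.
Proof.
exact: (big_morph (fun c => comb c x) (fun c d => combD c d x) (comb0 x)).
Qed.

Lemma comb_mulmx c (A : 'M[{poly K}]_m) x :
  comb (c *m A) x = \sum_i (c 0 i).{x} * comb (row i A) x.
Proof.
rewrite mulmx_sum_row comb_sum.
by apply: eq_bigr => i _; rewrite combZ.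
Qed.

(** g lies in the span of the W_i over the field of rational functions, as
    functions away from finitely many points; the denominator is cleared so
    that only polynomials occur. *)
Definition generated g : Prop :=
  exists b c, b != 0 /\ forall x, I x -> b.{x} != 0 -> b.{x} * g x = comb c x.

Lemma generated_common (n : nat) (h : 'I_n -> C R -> C R) :
  (forall i, generated (h i)) ->
  exists b (c : 'I_n -> 'rV[{poly K}]_m), b != 0 /\
    forall i x, I x -> b.{x} != 0 -> b.{x} * h i x = comb (c i) x.
Proof.
move=> hg.
have {hg} /fin_all_exists[bc bcP] : forall i, exists bc : {poly K} * 'rV[{poly K}]_m,
    bc.1 != 0 /\ forall x, I x -> bc.1.{x} != 0 -> bc.1.{x} * h i x = comb bc.2 x.
  by move=> i; have [b [c]] := hg i; exists (b, c).
exists (\prod_i (bc i).1), (fun i => (\prod_(j | j != i) (bc j).1) *: (bc i).2).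
split; first by apply/prodf_neq0 => i _; have [] := bcP i.
move=> i x Ix; rewrite (bigD1 i) //= pevalM combZ mulf_eq0 negb_or => /andP[bi0 _].
by have [_ <-//] := bcP i; ring.
Qed.

(** The span is closed under solving a linear equation with polynomial
    coefficients for a function whose coefficient is not the zero polynomial. *)
Lemma generated_solve (n : nat) (h : 'I_n -> C R -> C R)
    (a : 'I_n -> {poly K}) b g :
  (forall i, generated (h i)) -> b != 0 ->
  (forall x, I x -> b.{x} != 0 -> b.{x} * g x = \sum_i (a i).{x} * h i x) ->
  generated g.
Proof.
move=> /generated_common[e [c [e0 ec]]] b0 bg.
exists (e * b), (\sum_i a i *: c i); split; first by rewrite mulf_neq0.
move=> x Ix; rewrite pevalM mulf_eq0 negb_or => /andP[ex0 bx0].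
rewrite -mulrA bg // mulr_sumr comb_sum; apply: eq_bigr => i _.
by rewrite combZ -ec //; ring.
Qed.

Lemma generated_window i : generated (W i).
Proof.
exists 1, (delta_mx 0 i); split; first exact: oner_neq0.
move=> x _ _; rewrite peval1 mul1r /comb (bigD1 i) //= mxE !eqxx peval1 mul1r.
by rewrite big1 ?addr0 // => j ji; rewrite mxE (negbTE ji) peval0 mul0r.
Qed.

Hypothesis hI : I `<=` limit_point I.
Variables (b : {poly K}) (A : 'M[{poly K}]_m).
Hypothesis W_derivable : forall i x, I x -> derivable_in I (W i) x.
Hypothesis W_system : forall i x, I x -> b.{x} != 0 ->
  b.{x} * deriv_in I (W i) x = comb (row i A) x.

Lemma is_deriv_in_comb c x : I x -> b.{x} != 0 ->
  is_deriv_in I (comb c) x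
    (comb (map_mx (@deriv K) c) x + (b.{x})^-1 * comb (c *m A) x).
Proof.
move=> Ix bx0; rewrite comb_mulmx mulr_sumr [comb (map_mx _ _) x]/comb -big_split /=.
rewrite -[comb c]/(fun y => \sum_i (c 0 i).{y} * W i y).
apply: is_deriv_in_sum => i; rewrite mxE -W_system //.
rewrite (_ : _^-1 * _ = (c 0 i).{x} * deriv_in I (W i) x); last by field.
apply: is_deriv_inM; first exact: is_deriv_in_peval.
exact/deriv_inP/W_derivable.
Qed.

(** Since b does not vanish near x, g^(j) = b^-(j+1) (jet j) W holds near x, so
    g^(j) can be differentiated once more there. *)
Lemma nderiv_in_jet g c :
  (forall x, I x -> b.{x} != 0 -> b.{x} * g x = comb c x) ->
  forall j x, I x -> b.{x} != 0 ->
    nderivable_in I j g x /\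
    b.{x} ^+ j.+1 * nderiv_in I j g x = comb (jet b A c j) x.
Proof.
move=> bg; elim=> [|j IHj] x Ix bx0; first by split=> //=; rewrite expr1 bg.
pose q := b ^+ j.+1.
have qx0 : q.{x} != 0 by rewrite pevalX expf_neq0.
have near_b := near_peval_neq0 I bx0.
have dgx := is_deriv_inM (is_deriv_inV qx0 (@is_deriv_in_peval _ _ iota I q x))
                         (@is_deriv_in_comb (jet b A c j) x Ix bx0).
have near_g : \forall y \near within I (nbhs x),
    (q.{y})^-1 * comb (jet b A c j) y = nderiv_in I j g y.
  apply: near_within_sub near_b => y Iy by0; have [_ <-] := IHj y Iy by0.
  by rewrite /q pevalX mulKf // expf_neq0.
have gj := is_deriv_in_near Ix near_g dgx.
split.
  split; last exact: is_deriv_in_derivable gj.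
  by apply: near_within_sub near_b => y Iy by0; have [] := IHj y Iy by0.
rewrite -[nderiv_in _ _ _]/(deriv_in I (nderiv_in I j g)).
rewrite (deriv_inE _ gj); last exact: hI.
rewrite jetS !combD combN !combZ /q deriv_exp !pevalX !pevalMn pevalM pevalX [j.+1.-1]/=.
have : b.{x} ^+ j != 0 by rewrite expf_neq0.
rewrite !exprS -[_ *+ j.+1]mulr_natr -[b^`().{x} *+ _]mulr_natr.
move: (_ ^+ j) (j.+1%:R) => e n e0; field.
by rewrite e0 bx0.
Qed.

(** The factor b^(k+1) in the coefficients both expresses the relation between
    jets as one between derivatives of g and makes the equation trivial at the
    zeros of b. *)
Lemma system_ode g c : b != 0 ->
  (forall x, I x -> b.{x} != 0 -> b.{x} * g x = comb c x) ->
  exists p : nat -> {poly K}, simple_ode_of_order iota I g m p.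
Proof.
move=> b0 /nderiv_in_jet gj; have [p [pm0 rel]] := jet_relation b A c.
exists (fun k => p k * b ^+ k.+1); split.
- by rewrite mulf_neq0 ?expf_neq0.
- move=> x Ix; rewrite pevalM pevalX mulf_eq0 expf_eq0 negb_or => /andP[_ bx0].
  by have [] := gj m x Ix bx0.
move=> x Ix _; have [bx0|bx0] := eqVneq (b.{x}) 0.
  by rewrite big1 // => k _; rewrite pevalM pevalX bx0 expr0n mulr0 mul0r.
rewrite -[RHS](comb0 x) -[in RHS]rel comb_sum; apply: eq_bigr => k _.
by rewrite pevalM pevalX -mulrA combZ; have [_ ->] := gj k x Ix bx0.
Qed.

End Systems.

(** * Chains of functions with a two-sided recurrence *)

Section Chains.
Variables (R : realType) (K : fieldType) (iota : {rmorphism K -> C R}).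
Variables (I : set (C R)) (m : nat) (h : nat -> C R -> C R).
Local Notation "p .{ x }" := (peval iota p x) (at level 2, format "p .{ x }").

Variable Q : nat -> nat -> {poly K}.
Hypothesis Q0 : forall j, Q 0%N j != 0.
Hypothesis Qm : forall j, Q m j != 0.
Hypothesis Qrec : forall j x, I x -> \sum_(k < m.+1) (Q k j).{x} * h (j + k)%N x = 0.

(** The recurrence is solved for its last term to move up from the window
    h_s, ..., h_(s+m-1), and for its first term to move down. *)
Lemma chain_generated s j : generated iota I (fun i : 'I_m => h (s + i)%N) (h j).
Proof.
set W := (fun i : 'I_m => h (s + i)%N).
have up d : forall i, (s <= i < s + m + d)%N -> generated iota I W (h i).
  elim: d => [|d IHd] i /andP[si id].
    have im : (i - s < m)%N by lia.
    have -> : h i = W (Ordinal im) by rewrite /W /= subnKC.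
    exact: generated_window.
  have [im|mi] := ltnP i (s + m); first by apply: IHd; lia.
  apply: (@generated_solve _ _ _ _ _ _ _ (fun k : 'I_m => h (i - m + k)%N)
            (fun k : 'I_m => - Q k (i - m)) _ _ _ (Qm (i - m))).
    by move=> k; apply: IHd; have := ltn_ord k; lia.
  move=> x Ix _; have := Qrec (i - m) Ix.
  rewrite big_ord_recr /= addrC subnK; last by lia.
  move=> /eqP; rewrite addr_eq0 => /eqP->; rewrite -sumrN.
  by apply: eq_bigr => k _; rewrite pevalN mulNr.
have down d : forall i, (s - d <= i)%N -> generated iota I W (h i).
  elim: d => [|d IHd] i di; first by apply: (up i.+1); lia.
  have [ilt|ige] := ltnP i (s - d); last exact: IHd.
  apply: (@generated_solve _ _ _ _ _ _ _ (fun k : 'I_m => h (i + k.+1)%N)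
            (fun k : 'I_m => - Q k.+1 i) _ _ _ (Q0 i)).
    by move=> k; apply: IHd; lia.
  move=> x Ix _; have := Qrec i Ix; rewrite big_ord_recl /= addn0.
  move=> /eqP; rewrite addr_eq0 => /eqP->; rewrite -sumrN.
  by apply: eq_bigr => k _; rewrite pevalN mulNr.
by apply: (down s); lia.
Qed.

Hypothesis hI : I `<=` limit_point I.
Hypothesis h_derivable : forall j x, I x -> derivable_in I (h j) x.

(** The derivative rule is required only from some index s on: a rule reaching
    back along the chain makes no sense for the first members.  The map u
    covers rules reaching in either direction. *)
Lemma chain_ode (s M : nat) (u : nat -> nat -> nat) :
  (forall j, (s <= j)%N -> exists (e : {poly K}) (a : nat -> {poly K}), e != 0 /\
     forall x, I x -> e.{x} != 0 ->
       e.{x} * deriv_in I (h j) x = \sum_(k < M) (a k).{x} * h (u j k) x) ->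
  forall j, exists p : nat -> {poly K}, simple_ode_of_order iota I (h j) m p.
Proof.
move=> rule j; pose W := (fun i : 'I_m => h (s + i)%N).
have Wg i : generated iota I W (deriv_in I (W i)).
  have [e [a [e0 eh]]] := rule (s + i)%N (leq_addr _ _).
  apply: (@generated_solve _ _ _ _ _ _ _ (fun k : 'I_M => h (u (s + i)%N k))
            (fun k : 'I_M => a k) _ _ _ e0) => // k.
  exact: chain_generated.
(* A common denominator b is taken for the system and for h_j at once. *)
pose G (i : 'I_m.+1) := if unlift ord0 i is Some i' then deriv_in I (W i') else h j.
have [|b [c [b0 bc]]] := @generated_common _ _ iota I _ W _ G.
  by move=> i; rewrite /G; case: unlift => [i'|]; [exact: Wg | exact: chain_generated].
have W_derivable (i : 'I_m) x : I x -> derivable_in I (W i) x.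
  exact: h_derivable.
have W_system (i : 'I_m) x : I x -> b.{x} != 0 ->
    b.{x} * deriv_in I (W i) x = comb iota W (row i (\matrix_i c (lift ord0 i))) x.
  by move=> Ix bx0; rewrite rowK -bc // /G liftK.
have h_comb x : I x -> b.{x} != 0 -> b.{x} * h j x = comb iota W (c ord0) x.
  by move=> Ix bx0; rewrite -bc // /G unlift_none.
exact (system_ode hI W_derivable W_system b0 h_comb).
Qed.

End Chains.

(** * Clearing denominators in the derivative rule *)

Section Fractions.
Variable K : fieldType.

Lemma fractionE (r : {fraction {poly K}}) :
  exists a b : {poly K}, b != 0 /\ r = tofrac a / tofrac b.
Proof.
elim/quotW: r => r; exists (frac r).1, (frac r).2.
split; first exact: denom_ratioP.
rewrite /tofrac; unlock; rewrite !piE.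
have r20 := denom_ratioP r.
rewrite /FracField.mulf /FracField.invf !numden_Ratio ?oner_eq0 //.
by rewrite mulr1 mul1r Ratio_numden.
Qed.

Lemma fraction_common (M : nat) (r : nat -> {fraction {poly K}}) :
  exists (e : {poly K}) (a : nat -> {poly K}), e != 0 /\
    forall k, (k < M)%N -> r k = tofrac (a k) / tofrac e.
Proof.
elim: M => [|M [e [a [e0 rE]]]]; first by exists 1, (fun=> 0); rewrite oner_neq0.
have [a' [b [b0 rM]]] := fractionE (r M).
exists (e * b), (fun k => if (k == M)%N then a' * e else a k * b).
split; first by rewrite mulf_neq0.
move=> k; rewrite ltnS leq_eqVlt; case: eqP => [-> _|_ /= kM].
  by rewrite rM [e * b]mulrC !tofracM -mulf_div divff ?mulr1 ?tofrac_eq0.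
by rewrite rE // !tofracM -mulf_div divff ?mulr1 ?tofrac_eq0.
Qed.

End Fractions.

Lemma rule_clear_denominators (R : realType) (K : fieldType)
    (iota : {rmorphism K -> C R}) (I : set (C R)) (M : nat)
    (r : nat -> {fraction {poly K}}) (g : C R -> C R)
    (w : nat -> C R -> C R) :
  (forall x, I x -> forall v : nat -> C R,
     (forall k, (k < M)%N -> rat_value iota (r k) x (v k)) ->
     deriv_in I g x = \sum_(k < M) v k * w k x) ->
  exists (e : {poly K}) (a : nat -> {poly K}), e != 0 /\
    forall x, I x -> peval iota e x != 0 ->
      peval iota e x * deriv_in I g x = \sum_(k < M) peval iota (a k) x * w k x.
Proof.
move=> rule; have [e [a [e0 rE]]] := fraction_common M r.
exists e, a; split=> // x Ix ex0.
rewrite (rule x Ix (fun k => peval iota (a k) x / peval iota e x)).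
  by rewrite mulr_sumr; apply: eq_bigr => k _; field.
by move=> k kM; exists (a k), e; rewrite rE.
Qed.

(** * The differential equation of an admissible family *)

Theorem corollary1 (R : realType) (K : ground) (I D : set (C R))
    (hI : I `<=` limit_point I)
    (hD : (forall n, D n -> D (n + 1)) \/ (forall n, D n -> D (n - 1)))
    (f : C R -> C R -> C R) (m : nat) (hm : (0 < m)%N)
    (hf : admissible_of_order (ground_emb R K) I D f m) :
  exists p : nat -> C R -> {poly ground_field R K},
    forall n, D n ->
      simple_ode_of_order (ground_emb R K) I (f n) m (fun k => p k n).
Proof.
move: K hf => G; move: (ground_field R G) (ground_emb R G) => K iota.
move=> [[q qrec] [f_derivable [M M0 [r rule]]]].
suff ode n : D n -> exists p : nat -> {poly K}, simple_ode_of_order iota I (f n) m p.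
  have {}ode n : exists p : nat -> {poly K}, D n -> simple_ode_of_order iota I (f n) m p.
    by have [/ode[p]|] := pselect (D n); [exists p | exists (fun=> 0)].
  have [p pP] := choice ode.
  by exists (fun k n => p n k).
move=> Dn; case: hD => hD.
- have Dk k : D (n + k%:R).
    elim: k => [|k /hD]; first by rewrite addr0.
    by rewrite -addrA natr1.
  have sub i k : (k <= i)%N -> n + i%:R - k%:R = n + (i - k)%:R.
    by move=> ki; rewrite natrB // addrA.
  have add i k : n + i%:R + k%:R = n + (i + k)%:R by rewrite natrD addrA.
  have Dsub j k : (k <= m)%N -> D (n + (j + m)%:R - k%:R).
    by move=> km; rewrite sub; [exact: Dk | lia].
  have q0 j : q 0%N (n + (j + m)%:R) != 0 by have [] := qrec _ (Dsub j).
  have qm j : q m (n + (j + m)%:R) != 0 by have [] := qrec _ (Dsub j).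
  have hrec j x : I x -> \sum_(k < m.+1)
      peval iota (q (m - k)%N (n + (j + m)%:R)) x * f (n + (j + k)%:R) x = 0.
    move=> Ix; have [_ _ /(_ x Ix)] := qrec _ (Dsub j).
    rewrite (reindex_inj rev_ord_inj) /= => qs; rewrite -[RHS]qs.
    apply: eq_bigr => k _; have := ltn_ord k; rewrite subSS => km.
    by rewrite sub; [congr (_ * f (n + _%:R) x); lia | lia].
  (* Along n, n + 1, ... the recurrence is read from its last term. *)
  pose Q k j := q (m - k)%N (n + (j + m)%:R).
  have Q0 j : Q 0%N j != 0 by rewrite /Q subn0.
  have Qm j : Q m j != 0 by rewrite /Q subnn.
  have hd j x : I x -> derivable_in I (f (n + j%:R)) x.
    by apply: f_derivable; exact: Dk.
  have ode s u rule' := @chain_ode _ _ _ _ _ (fun j => f (n + j%:R)) Q Q0 Qm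
    hrec hI hd s M u rule' 0%N.
  (* n is the member of index 0 of its chain. *)
  rewrite -[n]addr0 -[0](mulr0n 1).
  case: rule => rule.
  + (* The backward rule at n + j stays within n, n + 1, ... once j >= M. *)
    apply: (ode M (fun j k => (j - k)%N)) => j Mj.
    apply: (@rule_clear_denominators _ _ _ _ _ (r^~ (n + j%:R))
      _ (fun k => f (n + (j - k)%:R))) => x Ix v vr.
    rewrite (rule _ _ _ Ix _ vr) => [|k kM]; last by rewrite sub; [exact: Dk | lia].
    by apply: eq_bigr => k _; rewrite sub //; have := ltn_ord k; lia.
  + apply: (ode 0%N (fun j k => (j + k)%N)) => j _.
    apply: (@rule_clear_denominators _ _ _ _ _ (r^~ (n + j%:R))
      _ (fun k => f (n + (j + k)%:R))) => x Ix v vr.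
    rewrite (rule _ _ _ Ix _ vr) => [|k kM]; last by rewrite add.
    by apply: eq_bigr => k _; rewrite add.
- have Dk k : D (n - k%:R).
    elim: k => [|k /hD]; first by rewrite subr0.
    by rewrite -addrA -opprD natr1.
  have sub i k : n - i%:R - k%:R = n - (i + k)%:R by rewrite natrD opprD addrA.
  have add i k : (k <= i)%N -> n - i%:R + k%:R = n - (i - k)%:R.
    by move=> ki; rewrite natrB // opprB addrA addrAC.
  have Dsub j k : (k <= m)%N -> D (n - j%:R - k%:R) by rewrite sub.
  pose Q k j := q k (n - j%:R).
  have Q0 j : Q 0%N j != 0 by have [] := qrec _ (Dsub j).
  have Qm j : Q m j != 0 by have [] := qrec _ (Dsub j).
  have hrec j x : I x -> \sum_(k < m.+1)
      peval iota (Q k j) x * f (n - (j + k)%:R) x = 0.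
    move=> Ix; have [_ _ /(_ x Ix) qs] := qrec _ (Dsub j).
    by rewrite -[RHS]qs; apply: eq_bigr => k _; rewrite sub.
  have hd j x : I x -> derivable_in I (f (n - j%:R)) x.
    by apply: f_derivable; exact: Dk.
  have ode s u rule' := @chain_ode _ _ _ _ _ (fun j => f (n - j%:R)) Q Q0 Qm
    hrec hI hd s M u rule' 0%N.
  rewrite -[n]subr0 -[0](mulr0n 1).
  case: rule => rule.
  + apply: (ode 0%N (fun j k => (j + k)%N)) => j _.
    apply: (@rule_clear_denominators _ _ _ _ _ (r^~ (n - j%:R))
      _ (fun k => f (n - (j + k)%:R))) => x Ix v vr.
    rewrite (rule _ _ _ Ix _ vr) => [|k kM]; last by rewrite sub.
    by apply: eq_bigr => k _; rewrite sub.
  + apply: (ode M (fun j k => (j - k)%N)) => j Mj.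
    apply: (@rule_clear_denominators _ _ _ _ _ (r^~ (n - j%:R))
      _ (fun k => f (n - (j - k)%:R))) => x Ix v vr.
    rewrite (rule _ _ _ Ix _ vr) => [|k kM]; last by rewrite add; [exact: Dk | lia].
    by apply: eq_bigr => k _; rewrite add //; have := ltn_ord k; lia.
Qed.
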